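(* $$\int_0^{\infty} e^{-x^2}\sinh(x)\,dx = \frac{\sqrt{\pi}}{2}\,e^{1/4}\,\mathrm{erf}\!\left(\frac{1}{2}\right).$$
   Context: The error function is $\mathrm{erf}(x)=\frac{2}{\sqrt{\pi}}\int_0^x e^{-t^2}\,dt$. *)

(* Defs.v *)
From Stdlib Require Import Reals.
From Coquelicot Require Import Coquelicot.
Open Scope R_scope.

Definition erf (x : R) : R :=
  2 / sqrt PI * RInt (fun t : R => exp (- t ^ 2)) 0 x.

(* Main.v *)
(** Completing the square gives
    [exp (-x^2) * sinh x = exp (1/4) / 2 * (g (x - 1/2) - g (x + 1/2))] with
    [g t = exp (-t^2)].  Hence, with [F x] the integral of [g] from [0] to [x],
    [exp (1/4) / 2 * (F (x - 1/2) - F (x + 1/2))] is an antiderivative of the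
    integrand.  It tends to [0] at infinity, since by the mean value theorem the
    difference is a value of [- g] at a point tending to infinity, and at [0] it
    is [- exp (1/4) * F (1/2)] because [F] is odd. *)
Require Import Defs.
From Stdlib Require Import Reals Lra.
From Coquelicot Require Import Coquelicot.
Open Scope R_scope.

Definition gauss (t : R) : R := exp (- t ^ 2).

Definition gauss_prim (x : R) : R := RInt gauss 0 x.

Lemma continuous_gauss (x : R) : continuous gauss x.
Proof.
  apply (ex_derive_continuous (V := R_NormedModule)).
  unfold gauss; auto_derive; trivial.
Qed.

Lemma ex_RInt_gauss (a b : R) : ex_RInt gauss a b.
Proof.
  apply (ex_RInt_continuous (V := R_CompleteNormedModule)).
  intros z _; apply continuous_gauss.
Qed.

Lemma is_derive_gauss_prim (x : R) : is_derive gauss_prim x (gauss x).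
Proof.
  apply (is_derive_RInt (V := R_NormedModule) gauss gauss_prim 0).
  - apply filter_forall; intros y.
    apply (RInt_correct (V := R_CompleteNormedModule)), ex_RInt_gauss.
  - apply continuous_gauss.
Qed.

Lemma gauss_prim_opp (x : R) : gauss_prim (- x) = - gauss_prim x.
Proof.
  apply is_RInt_unique.
  (* Evenness of [gauss] allows [- y]; of the two signs, the inner one is the Jacobian of [y -> - y]
     and the outer one negates the integral. *)
  apply (is_RInt_ext (fun y => opp (opp (gauss (- y))))).
  { intros y _; rewrite opp_opp; unfold gauss; f_equal; ring. }
  apply (is_RInt_opp (V := R_NormedModule) (fun y => opp (gauss (- y)))).
  apply (is_RInt_comp_opp (V := R_NormedModule)).
  rewrite Ropp_0, Ropp_involutive.
  apply (RInt_correct (V := R_CompleteNormedModule)), ex_RInt_gauss.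
Qed.

(** Follows from [exp (t ^ 2) >= 1 + t ^ 2 >= t]; this crude decay suffices for the squeeze at
    infinity. *)
Lemma gauss_le_inv (t : R) : 1 <= t -> gauss t <= / t.
Proof.
  intros Ht; unfold gauss; rewrite exp_Ropp.
  apply Rinv_le_contravar; [lra|].
  pose proof (exp_ineq1_le (t ^ 2)); nra.
Qed.

Definition gauss_sinh_prim (x : R) : R :=
  exp (1 / 4) / 2 * (gauss_prim (x - 1 / 2) - gauss_prim (x + 1 / 2)).

Lemma gauss_sinh_shift (x : R) :
  exp (- x ^ 2) * sinh x
  = exp (1 / 4) / 2 * (gauss (x - 1 / 2) - gauss (x + 1 / 2)).
Proof.
  unfold gauss, sinh.
  replace (- (x - 1 / 2) ^ 2) with (- x ^ 2 + x + - (1 / 4)) by field.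
  replace (- (x + 1 / 2) ^ 2) with (- x ^ 2 + - x + - (1 / 4)) by field.
  rewrite !exp_plus, (exp_Ropp (1 / 4)).
  field; apply Rgt_not_eq, exp_pos.
Qed.

Lemma is_derive_gauss_sinh_prim (x : R) :
  is_derive gauss_sinh_prim x (exp (- x ^ 2) * sinh x).
Proof.
  rewrite gauss_sinh_shift; unfold gauss_sinh_prim.
  pose proof (is_derive_gauss_prim (x - 1 / 2)) as Hm.
  pose proof (is_derive_gauss_prim (x + 1 / 2)) as Hp.
  auto_derive.
  - repeat split; eexists; eassumption.
  - change (fun x0 : R => gauss_prim x0) with gauss_prim.
    replace (x + - (1 / 2)) with (x - 1 / 2) by ring.
    rewrite (is_derive_unique _ _ _ Hm), (is_derive_unique _ _ _ Hp); ring.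
Qed.

(** The window has length 1, so the difference is [gauss c] for some [c] in it; [3 / 2 <= x] ensures
    [1 <= c], as [gauss_le_inv] requires. *)
Lemma gauss_prim_window (x : R) :
  3 / 2 <= x ->
  0 <= gauss_prim (x + 1 / 2) - gauss_prim (x - 1 / 2) <= / (x - 1 / 2).
Proof.
  intros Hx.
  destruct (MVT_gen gauss_prim (x - 1 / 2) (x + 1 / 2) gauss) as [c [Hc E]].
  - intros y _; apply is_derive_gauss_prim.
  - intros y _; apply continuity_pt_filterlim.
    apply (ex_derive_continuous (V := R_NormedModule)).
    eexists; apply is_derive_gauss_prim.
  - rewrite Rmin_left, Rmax_right in Hc by lra.
    replace (x + 1 / 2 - (x - 1 / 2)) with 1 in E by field.
    rewrite E, Rmult_1_r; split.
    + left; apply exp_pos.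
    + apply Rle_trans with (/ c); [apply gauss_le_inv; lra|].
      apply Rinv_le_contravar; lra.
Qed.

Lemma is_lim_gauss_sinh_prim : is_lim gauss_sinh_prim p_infty 0.
Proof.
  replace (Finite 0) with (Rbar_mult (exp (1 / 4) / 2) 0)
    by (simpl; f_equal; ring).
  apply is_lim_scal_l.
  (* The difference here is opposite to that of [gauss_prim_window], so the bounds change sign and
     swap. *)
  apply (is_lim_le_le_loc (fun x => - / (x - 1 / 2)) (fun _ => 0)).
  - exists 2; intros x Hx.
    pose proof (gauss_prim_window x); lra.
  - replace (Finite 0) with (Rbar_opp (Rbar_inv p_infty))
      by (simpl; f_equal; ring).
    apply is_lim_opp, is_lim_inv; [|discriminate].
    apply (is_lim_minus _ _ _ p_infty (1 / 2));
      [apply is_lim_id | apply is_lim_const | reflexivity].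
  - apply is_lim_const.
Qed.

Theorem theorem4p6 :
  is_RInt_gen (fun x : R => exp (- x ^ 2) * sinh x)
    (at_point 0) (Rbar_locally p_infty)
    (sqrt PI / 2 * exp (1 / 4) * erf (1 / 2)).
Proof.
  (* The value takes the form of the limit at infinity minus the limit at 0, as [is_RInt_gen_Derive]
     expects. *)
  replace (sqrt PI / 2 * exp (1 / 4) * erf (1 / 2))
    with (0 - gauss_sinh_prim 0).
  2: { unfold gauss_sinh_prim, erf.
       change (RInt (fun t : R => exp (- t ^ 2)) 0 (1 / 2))
         with (gauss_prim (1 / 2)).
       rewrite (Rminus_0_l (1 / 2)), gauss_prim_opp, Rplus_0_l.
       field; apply Rgt_not_eq, sqrt_lt_R0, PI_RGT_0. }
  assert (HD : forall x, Derive gauss_sinh_prim x = exp (- x ^ 2) * sinh x)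
    by (intros x; apply is_derive_unique, is_derive_gauss_sinh_prim).
  apply (is_RInt_gen_ext (Derive gauss_sinh_prim)).
  { apply filter_forall; intros ab x _; apply HD. }
  apply is_RInt_gen_Derive.
  - apply filter_forall; intros ab x _.
    eexists; apply is_derive_gauss_sinh_prim.
  - apply filter_forall; intros ab x _.
    apply (continuous_ext (fun y => exp (- y ^ 2) * sinh y)).
    { intros y; symmetry; apply HD. }
    apply (ex_derive_continuous (V := R_NormedModule)).
    unfold sinh; auto_derive; trivial.
  (* Along [at_point 0] the limit is the value at 0: a neighbourhood of a point contains that
     point. *)
  - intros P HP; exact (locally_singleton _ _ HP).
  - exact is_lim_gauss_sinh_prim.
Qed.
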